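(* Let $V$ be a 4-dimensional real vector space with basis $a_1,a_2,a_3,a_4$, let $a_5=a_1+a_2+a_3-a_4$, let $V^+=\{\sum_{k=1}^5 r_ka_k : r_k\ge0\}$, and let $e=a_1+a_2+a_3=a_4+a_5$. Let $\mathcal{N}=\{1,2,3\}$, and for each $\alpha\subset\mathcal{N}$ let $\phi_\alpha$ be a coherent Lüders's rule for the effect $\sum_{k\in\alpha}a_k$. Then for every $\alpha\subsetneq\mathcal{N}$ the map $\phi_\alpha$ is of the form $$\phi_\alpha(x)=\sum_{k\in\alpha}\omega_k^\alpha(x)\,a_k\qquad(x\in V),$$ with states $\omega_k^\alpha$ satisfying $\omega_k^\alpha(a_k)=1$, and any choice of such states gives a coherent Lüders's rule for $\sum_{k\in\alpha}a_k$; moreover $\phi_{\mathcal{N}}=\mathrm{id}$. Consequently, the triple-slit interference term is nonvanishing, $\eta_{\mathcal{N}}\ne0$, where the linear maps $\eta_\alpha$ are defined recursively by $\phi_\alpha=\sum_{\beta\subset\alpha}\eta_\beta$ for all $\alpha\subset\mathcal{N}$.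
   Context: For $x,y\in V$ write $x\ge y$ iff $x-y\in V^+$. An effect is an element $f$ with $0\le f\le e$. A state is a linear functional $\omega\colon V\to\mathbb{R}$ with $\omega(e)=1$ and $\omega(V^+)\subset[0,\infty)$. A coherent Lüders's rule for an effect $f$ is a linear map $\phi\colon V\to V$ with $\phi(V^+)\subset V^+$, $\phi(e)=f$, and $\phi(g)=g$ for every $g\in V^+$ with $g\le f$. In the sum $\sum_{\beta\subset\alpha}$ all subsets, including $\emptyset$ and $\alpha$ itself, are allowed. The map $\phi_\alpha$ describes the measurement ''the particle passed through one of the slits in $\alpha$'', and $\eta_\alpha$ is the corresponding interference term of order $|\alpha|$. *)

(* Defs.v *)
From HB Require Import structures.
From mathcomp Require Import all_boot all_order all_algebra.
From mathcomp Require Import classical_sets reals.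
Set Implicit Arguments.
Unset Strict Implicit.
Unset Printing Implicit Defensive.
Import Order.TTheory GRing.Theory Num.Theory.
Local Open Scope ring_scope.

Section OrderedVectorSpace.
Variables (R : realType) (V : vectType R).

Definition cone_gen (n : nat) (a : n.-tuple V) : set V :=
  fun x => exists2 r : 'I_n -> R,
    (forall k, 0 <= r k) & x = \sum_(k < n) r k *: tnth a k.

Variable Vp : set V.

Definition cone_le (x y : V) : Prop := Vp (y - x).

Variable e : V.

Definition is_effect (f : V) : Prop := cone_le 0 f /\ cone_le f e.

Definition is_state (omega : V -> R) : Prop :=
  [/\ scalar omega, omega e = 1 & forall x, Vp x -> 0 <= omega x].

Definition coherent_luders (f : V) (phi : V -> V) : Prop :=
  is_effect f /\
  [/\ linear phi,
      (forall x, Vp x -> Vp (phi x)),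
      phi e = f
    & forall g, Vp g -> cone_le g f -> phi g = g].

End OrderedVectorSpace.

(* The relation determines eta by recursion on the cardinality of alpha:
   eta alpha is phi alpha minus the eta beta for beta a proper subset. *)
Definition interference_terms (R : realType) (V : vectType R) (n : nat)
    (phi eta : {ffun {set 'I_n} -> 'End(V)}) : Prop :=
  forall alpha : {set 'I_n},
    phi alpha = \sum_(beta : {set 'I_n} | beta \subset alpha) eta beta.

(* Main.v *)
Require Import Defs.
From HB Require Import structures.
From mathcomp Require Import all_boot all_order all_algebra.
From mathcomp Require Import classical_sets reals.

Set Implicit Arguments.
Unset Strict Implicit.
Unset Printing Implicit Defensive.
Import Order.TTheory GRing.Theory Num.Theory.
Local Open Scope ring_scope.

(** The cone consists of the [x = x1 a1 + x2 a2 + x3 a3 + x4 a4] with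
    [xi >= 0] and [xi + x4 >= 0] for [i <= 3]. If [i] lies outside [alpha], the
    two inequalities at [i] force every [g] between [0] and
    [f = \sum_(k in alpha) a k] to satisfy [gi = 0 = g4], so the order interval
    [[0, f]] lies in the span of the [a k], [k \in alpha]. Since every generator
    lies below [e], a positive map sending [e] to [f] sends it into that
    interval. For the full index set the generators are fixed, so the map is
    the identity, which is not a combination of the other [phi alpha] because
    all of these have vanishing [a4]-coordinate. *)

(** * Inversion of sums over subsets, with values in an abelian group *)

Section SubsetInversion.
Variables (T : finType) (U : zmodType).
Implicit Types (f g : {set T} -> U) (A B : {set T}).

Lemma sum_subset_recr g A :
  \sum_(B : {set T} | B \subset A) g B = g A + \sum_(B : {set T} | B \proper A) g B.
Proof.
rewrite (bigD1 A) //=; congr (_ + _); apply: eq_bigl => B.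
by rewrite finset.properEneq andbC.
Qed.

(** Recursion on cardinality: a solution on the sets with fewer than [m] elements extends to those
    with [m] elements by the value that the equation forces. *)
Lemma ex_subset_inversion f :
  exists g : {ffun {set T} -> U}, forall A, f A = \sum_(B : {set T} | B \subset A) g B.
Proof.
suff [g Hg] : exists g : {ffun {set T} -> U}, forall A, (#|A| < #|T|.+1)%N ->
    f A = \sum_(B : {set T} | B \subset A) g B.
  by exists g => A; apply: Hg; rewrite ltnS max_card.
elim: #|T|.+1 => [|m [g Hg]]; first by exists [ffun=> 0].
(* Only the values at sets of exactly [m] elements matter in the second branch; those at larger sets
   are placeholders, overwritten at later stages. *)
exists [ffun A : {set T} =>
  if (#|A| < m)%N then g A else f A - \sum_(B : {set T} | B \proper A) g B] => A.
rewrite ltnS leq_eqVlt => /orP[/eqP Am|Am]; last first.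
  rewrite (Hg _ Am); apply: eq_bigr => B /subset_leq_card BA.
  by rewrite ffunE (leq_ltn_trans BA Am).
rewrite sum_subset_recr ffunE Am ltnn.
under [X in _ + X]eq_bigr => B BA do rewrite ffunE -Am (proper_card BA).
by rewrite subrK.
Qed.

(** The value [g A] is an integer combination of the [f B] with [B \subset A], so it stays in any
    subgroup [P] containing them. The trivial subgroup gives uniqueness of the inversion; the kernel
    of [h |-> d (h b)] gives the nonvanishing of the interference term. *)
Lemma subset_inversion_closed (P : U -> Prop) f g :
    (forall x y, P x -> P y -> P (x - y)) -> P 0 ->
    (forall A, f A = \sum_(B : {set T} | B \subset A) g B) ->
  forall A, (forall B, B \subset A -> P (f B)) -> P (g A).
Proof.
move=> PB P0 fg A; have [m] := ubnP #|A|; elim: m A => // m IH A Am Pf.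
have PD x y : P x -> P y -> P (x + y).
  by move=> Px Py; rewrite -[y]opprK -[- y]add0r; apply/PB/PB.
have -> : g A = f A - \sum_(B : {set T} | B \proper A) g B.
  by rewrite fg sum_subset_recr addrK.
apply: PB; first exact: Pf.
elim/big_ind: _ => // B BA; apply: IH.
  exact: leq_trans (proper_card BA) Am.
by move=> C CB; apply/Pf/(fintype.subset_trans CB)/proper_sub.
Qed.

Lemma subset_inversion_inj f g1 g2 :
    (forall A, f A = \sum_(B : {set T} | B \subset A) g1 B) ->
    (forall A, f A = \sum_(B : {set T} | B \subset A) g2 B) ->
  g1 =1 g2.
Proof.
move=> fg1 fg2 A; apply/eqP; rewrite -subr_eq0; apply/eqP.
apply: (@subset_inversion_closed (fun x => x = 0) (fun=> 0)
    (fun B => g1 B - g2 B)) => //.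
- by move=> x y -> ->; rewrite subr0.
- by move=> B; rewrite sumrB -fg1 -fg2 subrr.
Qed.

End SubsetInversion.

(** * The cone over a bipyramid whose base is the simplex of the [a k] and whose apexes are [b] and
    [e - b] *)

Section Bipyramid.
Variables (R : realType) (V : vectType R) (n : nat).
Variables (a : 'I_n -> V) (b : V) (c : 'I_n -> {scalar V}) (d : {scalar V}).
Hypothesis c_a : forall j k, c j (a k) = (j == k)%:R.
Hypothesis d_a : forall k, d (a k) = 0.
Hypothesis c_b : forall j, c j b = 0.
Hypothesis d_b : d b = 1.
Hypothesis coordE : forall x, x = \sum_k c k x *: a k + d x *: b.

(** Description by facets: both forms at [k] vanish at every [a j] with [j != k]; the first also
    vanishes at [b], the second at [e - b]. *)
Definition bipyramid : set V :=
  fun x => forall k, 0 <= c k x /\ 0 <= c k x + d x.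

Local Notation e := (\sum_k a k).
Implicit Types (A B : {set 'I_n}) (g x : V).

Lemma bipyramid0 : bipyramid 0.
Proof. by move=> k; rewrite !linear0 addr0 lexx. Qed.

Lemma bipyramidD x y : bipyramid x -> bipyramid y -> bipyramid (x + y).
Proof.
move=> Px Py k; have [[x1 x2] [y1 y2]] := (Px k, Py k).
split; first by rewrite linearD addr_ge0.
by rewrite !linearD addrACA addr_ge0.
Qed.

Lemma bipyramidZ r x : 0 <= r -> bipyramid x -> bipyramid (r *: x).
Proof.
move=> r0 Px k; have [x1 x2] := Px k.
split; first by rewrite linearZ mulr_ge0.
by rewrite !linearZ -mulrDr mulr_ge0.
Qed.

Lemma bipyramid_sum (I : finType) (P : pred I) (F : I -> V) :
  (forall i, P i -> bipyramid (F i)) -> bipyramid (\sum_(i | P i) F i).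
Proof.
by move=> HF; elim/big_ind: _ => //; [exact: bipyramid0 | exact: bipyramidD].
Qed.

Lemma bipyramid_a k : bipyramid (a k).
Proof. by move=> j; rewrite c_a d_a addr0 ler0n. Qed.

Lemma bipyramid_b : bipyramid b.
Proof. by move=> j; rewrite c_b d_b add0r lexx ler01. Qed.

Lemma c_suma A j : c j (\sum_(k in A) a k) = (j \in A)%:R.
Proof.
rewrite linear_sum /= (eq_bigr (fun k => (j == k)%:R)) => [|k _]; last exact: c_a.
case: (boolP (j \in A)) => jA.
  rewrite (bigD1 j) //= eqxx big1 ?addr0 // => k /andP[_ /negbTE].
  by rewrite eq_sym => ->.
by rewrite big1 // => k kA; case: eqP => // jk; rewrite -jk (negbTE jA) in kA.
Qed.

Lemma d_suma A : d (\sum_(k in A) a k) = 0.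
Proof. by rewrite linear_sum big1. Qed.

Lemma e_suma : e = \sum_(k in [set: 'I_n]%SET) a k.
Proof. by apply: eq_bigl => k; rewrite inE. Qed.

Lemma suma_le A B : A \subset B ->
  cone_le bipyramid (\sum_(k in A) a k) (\sum_(k in B) a k).
Proof.
move=> /fintype.subsetP AB j; rewrite !linearB /= !c_suma !d_suma subrr addr0.
suff: 0 <= (j \in B)%:R - (j \in A)%:R :> R by [].
by rewrite subr_ge0 ler_nat; case: (boolP (j \in A)) => // /AB ->.
Qed.

Lemma a_le_suma A k : k \in A -> cone_le bipyramid (a k) (\sum_(j in A) a j).
Proof.
by rewrite -finset.sub1set => /suma_le; rewrite big_set1.
Qed.

(** Unfolded, this places the second apex [e - b] in the cone, where each second inequality is an
    equality. *)
Lemma b_le_e : cone_le bipyramid b e.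
Proof.
move=> j; rewrite e_suma !linearB /= c_suma d_suma c_b d_b inE subr0 sub0r.
by rewrite subrr ler01.
Qed.

Lemma suma_effect A : is_effect bipyramid e (\sum_(k in A) a k).
Proof.
split; first by rewrite /cone_le subr0; apply: bipyramid_sum => k _; exact: bipyramid_a.
by rewrite e_suma; apply: suma_le; exact: finset.subsetT.
Qed.

Lemma le_suma_proper A g : A \proper [set: 'I_n]%SET ->
    bipyramid g -> cone_le bipyramid g (\sum_(k in A) a k) ->
  g = \sum_(k in A) c k g *: a k.
Proof.
move=> /fintype.properP[_ [i _ iA]] Pg gA.
have cg0 j : j \notin A -> c j g = 0.
  move=> jA; have [[cj _]] := (Pg j, gA j).
  rewrite linearB /= c_suma (negbTE jA) sub0r oppr_ge0 => -[jle _].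
  by apply/eqP; rewrite eq_le jle.
(* With [c i g = 0], the second inequalities at [i] for [g] and for [f - g] bound [d g] from below
   and from above by 0. *)
have dg0 : d g = 0.
  have [[_ di]] := (Pg i, gA i).
  rewrite !linearB /= c_suma d_suma (negbTE iA) cg0 // !sub0r oppr0 add0r.
  rewrite oppr_ge0 => -[_ dle]; rewrite cg0 // add0r in di.
  by apply/eqP; rewrite eq_le dle.
rewrite {1}[g]coordE dg0 scale0r addr0 [RHS]big_mkcond /=; apply: eq_bigr => k _.
by case: ifP => // /negbT kA; rewrite cg0 // scale0r.
Qed.

(** Packs the linearity of a state into a structure, so that the lemmas on linear maps apply. *)
Lemma state_scalar (omega : V -> R) :
  is_state bipyramid e omega -> exists om : {scalar V}, om =1 omega.
Proof.
move=> [lin_omega _ _].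
pose om : {scalar V} := HB.pack omega
  (GRing.isLinear.Build R V R *%R omega lin_omega).
by exists om.
Qed.

(** The nonnegative values at the generators [a j] add up to [omega e = 1], and the value at [a k]
    already exhausts this total. *)
Lemma state_a (omega : V -> R) k j :
    is_state bipyramid e omega -> omega (a k) = 1 ->
  omega (a j) = (k == j)%:R.
Proof.
move=> st omega_k; have [om omE] := state_scalar st.
have [_ omega_e omega_ge0] := st.
have [<-//|kj] := eqVneq k j.
have om_a_ge0 i : 0 <= om (a i) by rewrite omE; apply/omega_ge0/bipyramid_a.
have := omega_e; rewrite -!omE linear_sum (bigD1 k) //= omE omega_k.
move=> /(canRL (addKr _)); rewrite addNr => /eqP.
rewrite psumr_eq0 => [/allP/(_ j)|i _]; last exact: om_a_ge0.
by rewrite mem_index_enum eq_sym kj => /(_ isT)/eqP.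
Qed.

Lemma coherent_luders_of_states A (omega : 'I_n -> V -> R) :
    A \proper [set: 'I_n]%SET ->
    (forall k, k \in A -> is_state bipyramid e (omega k) /\ omega k (a k) = 1) ->
  coherent_luders bipyramid e (\sum_(k in A) a k)
    (fun x => \sum_(k in A) omega k x *: a k).
Proof.
move=> ppA st; split; first exact: suma_effect.
have lin : linear (fun x => \sum_(k in A) omega k x *: a k).
  move=> r x y; rewrite scaler_sumr -big_split; apply: eq_bigr => k kA /=.
  by have [[lin_k _ _] _] := st k kA; rewrite lin_k scalerDl scalerA.
split=> //.
- move=> x Px; apply: bipyramid_sum => k kA.
  have [[_ _ pos_k] _] := st k kA.
  by apply: bipyramidZ; [exact: pos_k | exact: bipyramid_a].
- by apply: eq_bigr => k kA; have [[_ -> _] _] := st k kA; rewrite scale1r.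
(* On the span of the [a j] with [j \in A], which contains [g], the state [omega k] agrees with the
   coordinate [c k] by [state_a]. *)
- move=> g Pg /(le_suma_proper ppA Pg) gE; rewrite [RHS]gE; apply: eq_bigr => k kA.
  congr (_ *: _); have [st_k omega_k] := st k kA.
  have [om omE] := state_scalar st_k.
  rewrite -!omE {1}gE linear_sum (bigD1 k) //= big1 ?addr0 => [|j /andP[_ jk]].
    by rewrite linearZ /= omE omega_k mulr1.
  rewrite linearZ /= omE (state_a _ st_k omega_k).
  by rewrite eq_sym (negbTE jk) mulr0.
Qed.

(** * The form of a given coherent Lüders's rule *)

Section Luders.
Variables (A : {set 'I_n}) (phi : 'End(V)).
Hypothesis phiA : coherent_luders bipyramid e (\sum_(k in A) a k) phi.

Lemma luders_setT : A = [set: 'I_n]%SET -> phi = \1%VF.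
Proof.
move=> AT; have [_ [_ _ _ fixed]] := phiA; apply/lfunP => x.
rewrite id_lfunE {1}[x]coordE linearD linear_sum /= [RHS]coordE; congr (_ + _).
  apply: eq_bigr => k _; rewrite linearZ /= fixed //; first exact: bipyramid_a.
  by apply: a_le_suma; rewrite AT inE.
by rewrite linearZ /= fixed ?AT -?e_suma; [| exact: bipyramid_b | exact: b_le_e].
Qed.

Hypothesis ppA : A \proper [set: 'I_n]%SET.

Lemma luders_span x : phi x = \sum_(k in A) c k (phi x) *: a k.
Proof.
have [_ [_ pos phi_e _]] := phiA.
have below_e y : bipyramid y -> cone_le bipyramid y e ->
    phi y = \sum_(k in A) c k (phi y) *: a k.
  move=> Py yle; apply: le_suma_proper => //; first exact: pos.
  by rewrite /cone_le -phi_e -linearB; apply: pos.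
(* The vectors satisfying [P] form a subspace, and it contains the basis [a k], [b], whose members
   all lie between 0 and [e]. *)
pose P y := phi y = \sum_(k in A) c k (phi y) *: a k.
have PD y z : P y -> P z -> P (y + z).
  rewrite /P => Py Pz; rewrite !linearD /= {1}Py {1}Pz -big_split.
  by apply: eq_bigr => k _ /=; rewrite -scalerDl !linearD.
have PZ r y : P y -> P (r *: y).
  rewrite /P => Py; rewrite linearZ /= {1}Py scaler_sumr.
  by apply: eq_bigr => k _; rewrite scalerA !linearZ.
have P0 : P 0 by rewrite /P linear0 big1 // => k _; rewrite !linear0 scale0r.
rewrite -/(P x) [x]coordE; apply: (PD).
  apply: (big_ind P P0 PD) => k _; apply: PZ; apply: below_e; first exact: bipyramid_a.
  by rewrite e_suma; apply: a_le_suma; rewrite inE.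
apply: PZ; apply: below_e; [exact: bipyramid_b | exact: b_le_e].
Qed.

Lemma luders_states :
  exists2 omega : 'I_n -> V -> R,
    (forall k, k \in A -> is_state bipyramid e (omega k) /\ omega k (a k) = 1)
    & forall x, phi x = \sum_(k in A) omega k x *: a k.
Proof.
have [_ [_ pos phi_e fixed]] := phiA.
(* The coordinate [c k] is nonnegative on the cone and takes the value 1 at [phi e] for [k \in A],
   so its composite with [phi] is a state. *)
exists (fun k x => c k (phi x)) => [k kA|x]; last exact: luders_span.
split; last by rewrite fixed ?c_a ?eqxx; [| exact: bipyramid_a | exact: a_le_suma].
split; first by move=> r x y; rewrite !linearP.
- by rewrite phi_e c_suma kA.
- by move=> x /pos Px; have [] := Px k.
Qed.

Lemma d_luders x : d (phi x) = 0.
Proof.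
by rewrite luders_span linear_sum big1 // => k _; rewrite linearZ /= d_a mulr0.
Qed.

End Luders.

(** Everything is tested at [b]: the identity gives [d b = 1], while each [eta A] with [A] proper
    sends [b] to a vector with [d]-coordinate 0. *)
Lemma interference_neq0 (phi eta : {ffun {set 'I_n} -> 'End(V)}) :
    (forall A, coherent_luders bipyramid e (\sum_(k in A) a k) (phi A)) ->
    interference_terms phi eta ->
  eta [set: 'I_n]%SET <> 0.
Proof.
move=> Hphi phi_eta eta0.
have d_eta A : A \proper [set: 'I_n]%SET -> d (eta A b) = 0.
  move=> ppA; apply: (subset_inversion_closed _ _ phi_eta
    (P := fun h : 'End(V) => d (h b) = 0)).
  - by move=> g h; rewrite add_lfunE opp_lfunE linearB /= => -> ->; rewrite subrr.
  - by rewrite zero_lfunE linear0.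
  - by move=> B BA; apply: d_luders (Hphi B) _ b; apply: sub_proper_trans BA ppA.
have /eqP := d_b; have -> : d b = d (phi [set: 'I_n]%SET b).
  by rewrite (luders_setT (Hphi _)) // id_lfunE.
rewrite phi_eta sum_subset_recr eta0 add0r sum_lfunE linear_sum /=.
by rewrite big1 => [|B /d_eta//]; rewrite eq_sym oner_eq0.
Qed.

End Bipyramid.

(** * The cone generated by [a1], ..., [a5] is a bipyramid cone with apexes [a4] and [a5] *)

Lemma cone_gen_bipyramid (R : realType) (V : vectType R)
    (a1 a2 a3 a4 a5 : V) (c : 'I_3 -> {scalar V}) (d : {scalar V})
    (a := tnth [tuple a1; a2; a3]) :
    a5 = a1 + a2 + a3 - a4 ->
    (forall j k, c j (a k) = (j == k)%:R) -> (forall k, d (a k) = 0) ->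
    (forall j, c j a4 = 0) -> d a4 = 1 ->
    (forall x, x = \sum_k c k x *: a k + d x *: a4) ->
  cone_gen [tuple a1; a2; a3; a4; a5] = bipyramid c d.
Proof.
move=> def_a5 c_a d_a c_b d_b coordE.
have a123 : a1 + a2 + a3 = \sum_k a k.
  by rewrite !big_ord_recl big_ord0 /= addr0 addrA.
rewrite a123 in def_a5.
apply/seteqP; split=> [_ [r r0 ->]|x Px].
  (* The generators are grouped into the base, the apex [a4] and the apex [a5 = e - a4]. *)
  rewrite (_ : \sum_k _ = \sum_(k < 3) r (widen_ord (isT : 3 <= 5)%N k) *: a k
      + r (inord 3) *: a4 + r (inord 4) *: a5).
    apply: bipyramidD; [apply: bipyramidD|]; rewrite ?def_a5.
    - apply: bipyramid_sum => k _; apply: bipyramidZ => //; exact: bipyramid_a.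
    - by apply: bipyramidZ => //; exact: bipyramid_b.
    - by apply: bipyramidZ => //; exact: b_le_e.
  rewrite !big_ord_recr !big_ord0 /= !add0r.
  by congr (_ *: _ + _ *: _ + _ *: _ + r _ *: _ + r _ *: _);
    [congr r | congr r | congr r | |]; apply: val_inj; rewrite /= ?inordK.
(* The smallest admissible weight of [a5] is the negative part of [d x]. *)
pose s := Num.max 0 (- d x).
have s0 : 0 <= s by rewrite le_max lexx.
have ds0 : 0 <= d x + s by rewrite addrC -lerBlDr sub0r le_max lexx orbT.
have cs0 k : 0 <= c k x - s.
  have [ck dk] := Px k; rewrite subr_ge0 ge_max ck /=.
  by rewrite -subr_ge0 opprK.
(* Since the [a k] have the same sum as [a4] and [a5], weight [s] can be moved from every base
   vertex to both apexes. *)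
have xE : x = \sum_k (c k x - s) *: a k + (d x + s) *: a4 + s *: a5.
  rewrite def_a5 {1}[x]coordE (eq_bigr _ (fun k _ => scalerBl _ _ _)) sumrB.
  rewrite -scaler_sumr scalerDl scalerBr -!addrA; congr (_ + _).
  by rewrite addrCA [s *: a4 + _]addrC subrK addNr addr0.
pose r := [tuple c ord0 x - s; c (lift ord0 ord0) x - s;
  c (lift ord0 (lift ord0 ord0)) x - s; d x + s; s].
exists (tnth r); first by case=> -[|[|[|[|[|//]]]]] ?; rewrite (tnth_nth 0) /=.
by rewrite {1}xE !big_ord_recl !big_ord0 !(tnth_nth 0) /= !addr0 -!addrA.
Qed.

(** * Specialization to the coordinates of the given basis *)

Theorem mainTheorem4 (R : realType) (V : vectType R)
    (a1 a2 a3 a4 a5 e : V) (Vp : set V) (a : 'I_3 -> V)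
    (dimV : \dim {:V} = 4%N)
    (basis_a : basis_of {:V} [:: a1; a2; a3; a4])
    (def_a5 : a5 = a1 + a2 + a3 - a4)
    (def_Vp : Vp = cone_gen [tuple a1; a2; a3; a4; a5])
    (def_e : e = a1 + a2 + a3)
    (def_a : a = tnth [tuple a1; a2; a3]) :
  e = a4 + a5 /\
  (forall alpha : {set 'I_3}, alpha \proper [set: 'I_3]%SET ->
     forall omega : 'I_3 -> V -> R,
       (forall k, k \in alpha ->
          is_state Vp e (omega k) /\ omega k (a k) = 1) ->
       coherent_luders Vp e (\sum_(k in alpha) a k)
         (fun x => \sum_(k in alpha) omega k x *: a k)) /\
  (forall phi : {ffun {set 'I_3} -> 'End(V)},
     (forall alpha : {set 'I_3},
        coherent_luders Vp e (\sum_(k in alpha) a k) (phi alpha)) ->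
     [/\ forall alpha : {set 'I_3}, alpha \proper [set: 'I_3]%SET ->
           exists2 omega : 'I_3 -> V -> R,
             (forall k, k \in alpha ->
                is_state Vp e (omega k) /\ omega k (a k) = 1)
             & forall x, phi alpha x = \sum_(k in alpha) omega k x *: a k,
         phi [set: 'I_3]%SET = \1%VF,
         (exists! eta : {ffun {set 'I_3} -> 'End(V)},
            interference_terms phi eta)
       & forall eta : {ffun {set 'I_3} -> 'End(V)},
           interference_terms phi eta -> eta [set: 'I_3]%SET <> 0]).
Proof.
(* Here [b] is the whole basis, and the apex called [b] above is [a4]: the first three coordinates
   serve as [c], the last one as [d]. *)
pose b := [tuple a1; a2; a3; a4].
have freeb : free b := basis_free basis_a.
pose c (k : 'I_3) : {scalar V} := coord b (widen_ord (leqnSn 3) k).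
pose d : {scalar V} := coord b ord_max.
have aE k : a k = b`_(widen_ord (leqnSn 3) k).
  by rewrite def_a (tnth_nth 0); case: k => -[|[|[|]]].
have cE k x : c k x = coord b (widen_ord (leqnSn 3) k) x by [].
have dE x : d x = coord b ord_max x by [].
have a4E : a4 = b`_(ord_max : 'I_4) by [].
have c_a j k : c j (a k) = (j == k)%:R by rewrite aE cE coord_free // eq_sym.
have d_a k : d (a k) = 0.
  by rewrite aE dE coord_free //; case: k => -[|[|[|]]].
have c_b j : c j a4 = 0.
  by rewrite a4E cE coord_free //; case: j => -[|[|[|]]].
have d_b : d a4 = 1 by rewrite a4E dE coord_free.
have coordE x : x = \sum_k c k x *: a k + d x *: a4.
  rewrite {1}(coord_basis basis_a (memvf x)) big_ord_recr /=; congr (_ + _).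
  by apply: eq_bigr => k _; rewrite aE.
have VpE : Vp = bipyramid c d.
  by rewrite def_Vp; apply: cone_gen_bipyramid => //; rewrite -def_a.
have eE : e = \sum_k a k.
  by rewrite def_e def_a !big_ord_recl big_ord0 /= addr0 addrA.
rewrite VpE; split; first by rewrite def_a5 def_e addrCA subrr addr0.
rewrite eE; split=> [alpha ppalpha omega|phi Hphi].
  exact: (coherent_luders_of_states c_a d_a coordE).
split.
- by move=> alpha; apply: (luders_states c_a d_a c_b d_b coordE).
- exact: (luders_setT c_a d_a c_b d_b coordE (Hphi _)).
- have [eta phi_eta] := ex_subset_inversion phi.
  exists eta; split=> // eta' phi_eta'; apply/ffunP.
  exact: (subset_inversion_inj phi_eta phi_eta').
- by move=> eta; apply: (interference_neq0 c_a d_a c_b d_b coordE).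
Qed.
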